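(* Let $n\ge 4$, let $s_i=(i,i+1)\in S_n$, and let $\pi$ be a real representation of $S_n$. Put $g_\pi=\frac{\chi_\pi(1)-\chi_\pi(s_1)}{2}$ and $h_\pi=\frac{\chi_\pi(1)-\chi_\pi(s_1s_3)}{2}$. The following are equivalent: \begin{enumerate} \item $\pi$ is spinorial; \item $g_\pi\equiv 0$ or $3\pmod 4$, and $h_\pi\equiv 0\pmod 4$; \item $\chi_\pi(1)-\chi_\pi(s_1)\equiv 0$ or $6\pmod 8$, and $\chi_\pi(1)\equiv\chi_\pi(s_1s_3)\pmod 8$. \end{enumerate} Moreover, when $\pi$ is spinorial it has exactly two lifts.
   Context: A real representation of a finite group $G$ on a Euclidean space $V$ is regarded as a homomorphism $\pi:G\to\mathrm{O}(V)$; $\chi_\pi$ is its character. $\mathrm{Pin}(V)$ is the Pin group of $V$ (constructed from the Clifford algebra with $v^2=-|v|^2$), with the standard double cover $\rho:\mathrm{Pin}(V)\to\mathrm{O}(V)$ of kernel $\{\pm1\}$. $\pi$ is spinorial if there exists a homomorphism $\hat\pi:G\to\mathrm{Pin}(V)$ with $\rho\circ\hat\pi=\pi$; such $\hat\pi$ is called a lift of $\pi$. *)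

(* Defs.v *)
From HB Require Import structures.
From mathcomp Require Import all_boot all_order all_fingroup all_algebra.
From mathcomp Require Import mxrepresentation.
From mathcomp Require Import reals.
Set Implicit Arguments. Unset Strict Implicit. Unset Printing Implicit Defensive.
Import Order.TTheory GRing.Theory Num.Theory.
Local Open Scope ring_scope.

Section Defs.
Variable R : realType.

(* Adjacent transposition s_i = (i, i+1) in S_n, with 1-based i, i.e. the
   transposition of the 0-based points i-1 and i (identity if out of range). *)
Definition adj_tr (n i : nat) : 'S_n :=
  match @insub nat (fun k => (k < n)%N) 'I_n i.-1, @insub nat (fun k => (k < n)%N) 'I_n i with
  | Some a, Some b => tperm a b
  | _, _ => 1%g
  end.

Definition real_rep (gT : finGroupType) (m : nat) (pi : gT -> 'M[R]_m) : Prop :=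
  mx_repr [set: gT] pi /\ forall g, (pi g)^T *m pi g = 1%:M.

Definition character (gT : finGroupType) (m : nat) (pi : gT -> 'M[R]_m) (g : gT) : R :=
  \tr (pi g).

(* Clifford algebra Cl(R^m) with v^2 = -|v|^2, on the basis e_A, A ⊆ {0..m-1},
   e_A = e_{a1} ... e_{ak} (a1 < ... < ak), e_i e_j = - e_j e_i (i<>j), e_i^2 = -1. *)
Definition Cl (m : nat) := {ffun {set 'I_m} -> R}.

(* e_A e_B = clsign A B * e_{A Δ B} *)
Definition clsign (m : nat) (A B : {set 'I_m}) : R :=
  (-1) ^+ (#|[set p : 'I_m * 'I_m | (p.1 \in A) && (p.2 \in B) && (p.2 < p.1)%N]|
           + #|A :&: B|)%N.

Definition clmul (m : nat) (x y : Cl m) : Cl m :=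
  [ffun C => \sum_(A : {set 'I_m}) \sum_(B : {set 'I_m} | (A :\: B) :|: (B :\: A) == C)
               clsign A B * x A * y B].

Definition cl1 (m : nat) : Cl m := [ffun A => (A == set0)%:R].

Definition clopp (m : nat) (x : Cl m) : Cl m := [ffun A => - x A].

Definition clvec (m : nat) (v : 'cV[R]_m) : Cl m :=
  [ffun A => \sum_(i : 'I_m | A == [set i]) v i 0].

Definition clalpha (m : nat) (x : Cl m) : Cl m := [ffun A : {set 'I_m} => (-1) ^+ #|A| * x A].

Definition unit_vec (m : nat) (v : 'cV[R]_m) : bool := (v^T *m v) 0 0 == 1.

(* Pin(V): the group generated by unit vectors (and -1), i.e. the elements
   +-u_1 ... u_k with u_i unit vectors. *)
Definition in_Pin (m : nat) (x : Cl m) : Prop :=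
  exists (e : bool) (s : seq 'cV[R]_m),
    all (@unit_vec m) s /\
    x = (if e then @clopp m else id) (foldr (@clmul m) (cl1 m) (map (@clvec m) s)).

(* rho(x) = M, where rho(x)(v) = alpha(x) v x^{-1} (twisted adjoint action);
   written without the inverse as alpha(x) v = rho(x)(v) x. *)
Definition rho_is (m : nat) (x : Cl m) (M : 'M[R]_m) : Prop :=
  forall v : 'cV[R]_m, clmul (clalpha x) (clvec v) = clmul (clvec (M *m v)) x.

Definition is_lift (gT : finGroupType) (m : nat) (pi : gT -> 'M[R]_m) (L : gT -> Cl m) : Prop :=
  [/\ forall g h, L (g * h)%g = clmul (L g) (L h),
      forall g, in_Pin (L g)
    & forall g, rho_is (L g) (pi g)].

Definition spinorial (gT : finGroupType) (m : nat) (pi : gT -> 'M[R]_m) : Prop :=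
  exists L, is_lift pi L.

End Defs.

(* Main.v *)
(** An involution [M] in O(V) whose (-1)-eigenspace has dimension [d] is a product of
    [d] commuting reflections in orthonormal vectors, so either of its lifts to Pin(V)
    is [+-u_1 ... u_d], with square [(-1)^(d(d+1)/2)]. For [s_1] and [s_1 s_3] the
    dimension [d] is [g_pi] and [h_pi]; [h_pi] is even because the lifts of the
    conjugate elements [s_1] and [s_3] have the same parity in the Clifford algebra. A
    lift of [pi] exists iff the images of the Coxeter generators can be lifted
    compatibly with the Coxeter relations of S_n. The relations [s_i^2 = 1] and [(s_i
    s_j)^2 = 1] for |i - j| > 1 hold or fail independently of the signs of the lifts
    and, by conjugacy, reduce to [s_1] and [s_1 s_3]; the braid relations only hold up
    to sign, and this is repaired by choosing the signs of the lifts one after the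
    other. The two lifts differ by the sign character. *)
Require Import Defs.
From HB Require Import structures.
From mathcomp Require Import all_boot all_order all_fingroup all_algebra.
From mathcomp Require Import mxrepresentation boolp reals zify ring.
Import Order.TTheory GRing.Theory Num.Theory.
Local Open Scope ring_scope.
Set Implicit Arguments.
Unset Strict Implicit.
Unset Printing Implicit Defensive.

(** * The Clifford algebra *)

Section SymmetricDifference.
Variable T : finType.
Implicit Types A B C : {set T}.

Definition symdiff A B := (A :\: B) :|: (B :\: A).

Lemma in_symdiff A B i : (i \in symdiff A B) = (i \in A) (+) (i \in B).
Proof. by rewrite !inE; case: (i \in A); case: (i \in B). Qed.

Lemma symdiffA A B C : symdiff A (symdiff B C) = symdiff (symdiff A B) C.
Proof. by apply/setP=> i; rewrite !in_symdiff addbA. Qed.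

Lemma symdiffC A B : symdiff A B = symdiff B A.
Proof. by apply/setP=> i; rewrite !in_symdiff addbC. Qed.

Lemma symdiff0 A : symdiff A set0 = A.
Proof. by apply/setP=> i; rewrite !in_symdiff inE addbF. Qed.

Lemma symdiffv A : symdiff A A = set0.
Proof. by apply/setP=> i; rewrite !in_symdiff inE addbb. Qed.

Lemma symdiffK A : involutive (symdiff A).
Proof. by move=> B; rewrite symdiffA symdiffv symdiffC symdiff0. Qed.

Lemma eq_symdiff A B C : (symdiff A B == C) = (B == symdiff A C).
Proof. by apply/eqP/eqP=> [<-|->]; rewrite symdiffK. Qed.

Lemma prod_symdiff (R : comPzRingType) A B (f : T -> R) :
  (forall i, f i * f i = 1) ->
  \prod_(i in symdiff A B) f i = (\prod_(i in A) f i) * \prod_(i in B) f i.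
Proof.
move=> ff; rewrite !(big_mkcond (fun i => i \in _)) -big_split /=.
apply: eq_bigr => i _; rewrite in_symdiff.
by case: (i \in A); case: (i \in B); rewrite ?ff ?mulr1 ?mul1r.
Qed.

End SymmetricDifference.

(** * Signs in products of Clifford basis elements *)

Section CliffordSign.
Variables (R : realType) (m : nat).
Implicit Types A B C : {set 'I_m}.
Local Notation sgn := (@clsign R m).

(** An inversion [b < a] and a coincidence [b = a] each contribute one factor -1, so together they
    count the pairs with [b <= a]. The product form is what exposes multiplicativity in each
    argument. *)
Lemma clsignE A B :
  sgn A B = \prod_(a in A) \prod_(b in B) (-1) ^+ (b <= a)%N.
Proof.
rewrite /clsign exprD pair_big /=.
transitivity (\prod_(p : 'I_m * 'I_m | (p.1 \in A) && (p.2 \in B))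
    ((-1) ^+ (p.2 < p.1)%N * (-1) ^+ (p.2 == p.1)) : R); last first.
  apply: eq_bigr => p _; rewrite -exprD -val_eqE /=.
  by case: ltngtP.
rewrite big_split /=; congr (_ * _).
  rewrite prodrXr -sum1_card; congr (_ ^+ _).
  rewrite [RHS]big_mkcond [LHS]big_mkcond /=; apply: eq_bigr => p _; rewrite inE.
  by case: (_ \in A) => //=; case: (_ \in B) => //=; case: (_ < _)%N.
rewrite prodrXr -sum1_card; congr (_ ^+ _).
have -> : (\sum_(p : 'I_m * 'I_m | (p.1 \in A) && (p.2 \in B)) (p.2 == p.1) =
  \sum_(a in A) \sum_(b in B) (b == a))%N by rewrite pair_big.
rewrite [LHS]big_mkcond [RHS]big_mkcond; apply: eq_bigr => a _ /=.
rewrite inE; case: (a \in A) => //=.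
have [aB|aB] := ifPn.
  by rewrite (bigD1 a) //= eqxx big1 // => i /andP[_ /negPf->].
by rewrite big1 // => i iB; case: eqP iB => // ->; rewrite (negPf aB).
Qed.

(** Elements common to [A] and [B] contribute squares of signs, which cancel. With its right-hand
    counterpart, this bimultiplicativity replaces all later sign bookkeeping, including the cocycle
    identity behind associativity. *)
Lemma clsignDl A B C : sgn (symdiff A B) C = sgn A C * sgn B C.
Proof.
rewrite !clsignE prod_symdiff // => i; rewrite -big_split big1 //= => j _.
by rewrite -expr2 sqrr_sign.
Qed.

Lemma clsignDr A B C : sgn A (symdiff B C) = sgn A B * sgn A C.
Proof.
rewrite !clsignE -big_split; apply: eq_bigr => i _.
by rewrite prod_symdiff // => j; rewrite -expr2 sqrr_sign.
Qed.

Lemma clsign0l A : sgn set0 A = 1.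
Proof. by rewrite clsignE big_set0. Qed.

Lemma clsign0r A : sgn A set0 = 1.
Proof. by rewrite clsignE big1 // => i _; rewrite big_set0. Qed.

Lemma clsignM A B : sgn A B * sgn A B = 1.
Proof. by rewrite /clsign -expr2 sqrr_sign. Qed.

Lemma clsign11 i j : sgn [set i] [set j] = (-1) ^+ (j <= i)%N.
Proof. by rewrite clsignE !big_set1. Qed.

Lemma sign_symdiff A B :
  (-1) ^+ #|symdiff A B| = (-1) ^+ #|A| * (-1) ^+ #|B| :> R.
Proof.
have E C : (-1) ^+ #|C| = \prod_(i in C) (-1) :> R.
  by rewrite prodr_const.
by rewrite !E prod_symdiff // => i; rewrite mulrNN mulr1.
Qed.

(* [e_A e_i] and [e_i e_A] differ by [(-1) ^ #|A \ {i}|]. *)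
Lemma clsign_swap1 A i :
  sgn A [set i] * sgn [set i] A = (-1) ^+ (#|A| + (i \in A)).
Proof.
rewrite !clsignE big_set1 -big_split exprD /=.
transitivity (\prod_(a in A) (-1) ^+ 1 * \prod_(a in A) (-1) ^+ (i == a) : R).
  rewrite -big_split; apply: eq_bigr => a _.
  rewrite big_set1 -!exprD -val_eqE /=. by case: ltngtP; rewrite ?mulr1 ?mulrNN ?expr1 ?sqrr_sign ?expr2 ?mulrNN ?mulr1.
rewrite !prodrXr -sum1_card; congr (_ * _ ^+ _).
case iA: (i \in A).
  rewrite (bigD1 i) //= eqxx big1 // => j /andP[_ /negPf].
  by rewrite eq_sym => ->.
by rewrite big1 // => j; case: eqP => // <-; rewrite iA.
Qed.

End CliffordSign.

(** * The algebra structure on [Cl] *)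

Section CliffordAlgebra.
Variables (R : realType) (m : nat).
Implicit Types (A B C : {set 'I_m}) (x y z : Cl R m) (v w : 'cV[R]_m).
Local Notation sgn := (@clsign R m).

HB.instance Definition _ := GRing.Lmodule.copy (Cl R m) {ffun {set 'I_m} -> R^o}.

(** Symmetric difference is a group law of exponent 2, so [A] and [C] determine the second index,
    and the double sum collapses to a single one. *)
Lemma clmulE x y C :
  clmul x y C = \sum_A sgn A (symdiff A C) * x A * y (symdiff A C).
Proof.
rewrite ffunE; apply: eq_bigr => A _.
by under eq_bigl => B do rewrite -/(symdiff A B) eq_symdiff; rewrite big_pred1_eq.
Qed.

Lemma clmulA : associative (@clmul R m).
Proof.
move=> x y z; apply/ffunP=> D; rewrite !clmulE.
under eq_bigr => A _ do rewrite clmulE big_distrr /=.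
under [RHS]eq_bigr => A _ do rewrite clmulE big_distrr big_distrl /=.
rewrite [RHS]exchange_big; apply: eq_bigr => A _.
(* The indices of [x], [y], [z] become [A], [B] and [F]; both signs then expand to
   [sgn A B * sgn A F * sgn B F]. *)
rewrite [RHS](reindex_inj (inv_inj (symdiffK A))); apply: eq_bigr => B _ /=.
rewrite symdiffK (symdiffC A B) -!symdiffA.
set F := symdiff B (symdiff A D).
have -> : symdiff A D = symdiff B F by rewrite symdiffK.
rewrite clsignDr clsignDl /=; ring.
Qed.

Lemma clmulDl : left_distributive (@clmul R m) +%R.
Proof.
move=> x y z; apply/ffunP=> C; rewrite [RHS]ffunE !clmulE -big_split.
by apply: eq_bigr => A _ /=; rewrite ffunE mulrDr mulrDl.
Qed.

Lemma clmulDr : right_distributive (@clmul R m) +%R.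
Proof.
move=> x y z; apply/ffunP=> C; rewrite [RHS]ffunE !clmulE -big_split.
by apply: eq_bigr => A _ /=; rewrite ffunE mulrDr.
Qed.

Lemma clmul1l : left_id (@cl1 R m) (@clmul R m).
Proof.
move=> x; apply/ffunP=> C; rewrite clmulE (bigD1 set0) //= big1 => [|A /negPf A0].
  by rewrite ffunE eqxx clsign0l symdiffC symdiff0 !mul1r addr0.
by rewrite ffunE A0 mulr0 mul0r.
Qed.

Lemma clmul1r : right_id (@cl1 R m) (@clmul R m).
Proof.
move=> x; apply/ffunP=> C; rewrite clmulE (bigD1 C) //= big1 => [|A AC].
  by rewrite ffunE symdiffv eqxx clsign0r mul1r mulr1 addr0.
rewrite ffunE eq_symdiff symdiff0 eq_sym; by rewrite (negPf AC) mulr0.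
Qed.

Lemma cl1_neq0 : cl1 R m != 0.
Proof. by apply/eqP=> /ffunP/(_ set0)/eqP; rewrite !ffunE eqxx oner_eq0. Qed.

HB.instance Definition _ := GRing.Zmodule_isNzRing.Build (Cl R m)
  clmulA clmul1l clmul1r clmulDl clmulDr cl1_neq0.

Lemma clscaleE (a : R) x A : (a *: x) A = a * x A.
Proof. by rewrite ffunE. Qed.

Lemma clscaleAl (a : R) x y : a *: (x * y) = (a *: x) * y.
Proof.
apply/ffunP=> C; rewrite clscaleE !clmulE mulr_sumr.
by apply: eq_bigr => A _ /=; rewrite clscaleE; ring.
Qed.

Lemma clscaleAr (a : R) x y : a *: (x * y) = x * (a *: y).
Proof.
apply/ffunP=> C; rewrite clscaleE !clmulE mulr_sumr.
by apply: eq_bigr => A _ /=; rewrite clscaleE; ring.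
Qed.

HB.instance Definition _ := GRing.Lmodule_isLalgebra.Build R (Cl R m) clscaleAl.
HB.instance Definition _ := GRing.Lalgebra_isAlgebra.Build R (Cl R m) clscaleAr.

End CliffordAlgebra.

(** * Conjugation, the grading involution and the Clifford relations *)

Section CliffordInvolutions.
Variables (R : realType) (m : nat).
Implicit Types (A B C : {set 'I_m}) (x y z : Cl R m) (v w u : 'cV[R]_m).
Local Notation sgn := (@clsign R m).
Local Notation e := (@clvec R m).

Definition dot v w : R := (v^T *m w) 0 0.

Lemma dotE v w : dot v w = \sum_i v i 0 * w i 0.
Proof. by rewrite /dot mxE; apply: eq_bigr => i _; rewrite mxE. Qed.

Lemma dotC v w : dot v w = dot w v.
Proof. by rewrite !dotE; apply: eq_bigr => i _; rewrite mulrC. Qed.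

(* The anti-automorphism of [Cl] extending [v |-> - v]; its sign on [e_A] is [clsign A
   A], the quadratic form polarising to [clsign A B * clsign B A]. *)
Definition clconj x : Cl R m := [ffun A => sgn A A * x A].

(** When [C] is the symmetric difference of [A] and [B], [sgn C C] expands into four factors; its
    [sgn A B] cancels the sign of the product, leaving [sgn B A], the sign of the reversed
    product. *)
Lemma clconjM x y : clconj (x * y) = clconj y * clconj x.
Proof.
apply/ffunP=> C; rewrite ffunE !clmulE mulr_sumr.
rewrite [RHS](reindex_inj (can_inj (fun A => symdiffK C A))); apply: eq_bigr => A _ /=.
rewrite ![symdiff C A]symdiffC -[symdiff (symdiff A C) C]symdiffA symdiffv symdiff0.
have := symdiffK A C; move: (symdiff A C) => B <-.
rewrite !ffunE !clsignDl !clsignDr.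
by have := clsignM R A B; move: (sgn A B) => t tt; ring: tt.
Qed.

Lemma clconjK : involutive clconj.
Proof. by move=> x; apply/ffunP=> A; rewrite !ffunE mulrA clsignM mul1r. Qed.

Lemma clconjN x : clconj (- x) = - clconj x.
Proof. by apply/ffunP=> A; rewrite !ffunE mulrN. Qed.

Lemma clconjZ a x : clconj (a *: x) = a *: clconj x.
Proof. by apply/ffunP=> A; rewrite ffunE !clscaleE ffunE mulrCA. Qed.

Lemma clconj1 : clconj 1 = 1.
Proof.
apply/ffunP=> A; rewrite !ffunE.
by case: eqP => [->|_]; rewrite ?clsign0l ?mulr0 ?mulr1.
Qed.

Lemma clalphaM x y : clalpha (x * y) = clalpha x * clalpha y.
Proof.
apply/ffunP=> C; rewrite ffunE !clmulE mulr_sumr; apply: eq_bigr => A _ /=.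
rewrite !ffunE sign_symdiff.
have := sqrr_sign R #|A|; rewrite expr2; move: ((-1) ^+ #|A|) => t tt.
by ring: tt.
Qed.

Lemma clalphaN x : clalpha (- x) = - clalpha x.
Proof. by apply/ffunP=> A; rewrite !ffunE mulrN. Qed.

Lemma clalpha1 : clalpha 1 = 1 :> Cl R m.
Proof.
apply/ffunP=> A; rewrite !ffunE.
by case: eqP => [->|_]; rewrite ?cards0 ?mulr0 ?mulr1.
Qed.

Lemma clvec1 v i : e v [set i] = v i 0.
Proof.
rewrite ffunE; under eq_bigl => j do rewrite (inj_eq set1_inj) eq_sym.
by rewrite big_pred1_eq.
Qed.

Lemma clvec_eq0 v A : (forall i, A != [set i]) -> e v A = 0.
Proof. by move=> Ai; rewrite ffunE big1 // => i; rewrite (negPf (Ai i)). Qed.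

Lemma clvec_ind (P : {set 'I_m} -> R -> Prop) v :
  (forall i, P [set i] (v i 0)) -> (forall A, P A 0) -> forall A, P A (e v A).
Proof.
move=> P1 P0 A; case: (pickP (fun i => A == [set i])) => [i /eqP->|Ai].
  by rewrite clvec1.
by rewrite clvec_eq0 // => i; rewrite Ai.
Qed.

Lemma clconj_vec v : clconj (e v) = - e v.
Proof.
apply/ffunP=> A; rewrite [LHS]ffunE [RHS]ffunE.
apply: (@clvec_ind (fun A t => sgn A A * t = - t)) => [i|B]; last by rewrite mulr0 oppr0.
by rewrite clsign11 leqnn expr1 mulN1r.
Qed.

Lemma clalpha_vec v : clalpha (e v) = - e v.
Proof.
apply/ffunP=> A; rewrite [LHS]ffunE [RHS]ffunE.
apply: (@clvec_ind (fun A t => (-1) ^+ #|A| * t = - t)) => [i|B]; last by rewrite mulr0 oppr0.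
by rewrite cards1 expr1 mulN1r.
Qed.

Lemma clvecD v w : e (v + w) = e v + e w.
Proof.
by apply/ffunP=> A; rewrite !ffunE -big_split; apply: eq_bigr => i _; rewrite mxE.
Qed.

Lemma clvecZ a v : e (a *: v) = a *: e v.
Proof.
apply/ffunP=> A; rewrite clscaleE !ffunE mulr_sumr.
by apply: eq_bigr => i _; rewrite mxE.
Qed.

Definition clbasis A : Cl R m := [ffun B => (B == A)%:R].

Lemma clbasisM A B : clbasis A * clbasis B = sgn A B *: clbasis (symdiff A B).
Proof.
apply/ffunP=> C; rewrite clmulE clscaleE (bigD1 A) //= big1 => [|D /negPf DA].
  rewrite !ffunE eqxx eq_symdiff addr0 mulr1.
  by case: eqP => [->|_]; rewrite ?mulr0 // symdiffK.
by rewrite !ffunE DA mulr0 mul0r.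
Qed.

Lemma clvec_basis v : e v = \sum_i v i 0 *: clbasis [set i].
Proof.
apply/ffunP=> A; rewrite sum_ffunE ffunE big_mkcond; apply: eq_bigr => i _.
by rewrite clscaleE ffunE; case: eqP => _; rewrite ?mulr1 ?mulr0.
Qed.

Lemma clbasis_anticomm (i j : 'I_m) :
  clbasis [set i] * clbasis [set j] + clbasis [set j] * clbasis [set i] =
  (- ((i == j)%:R *+ 2))%:A :> Cl R m.
Proof.
rewrite !clbasisM (symdiffC [set j]) -scalerDl !clsign11.
have [->|ij] := eqVneq i j.
  rewrite leqnn expr1 symdiffv /= mulr2n opprD; congr (_ *: _).
rewrite mulr0n mul0rn oppr0 scale0r.
by move: ij; rewrite -val_eqE /=; case: ltngtP => //; rewrite expr1 expr0 (addrN, addNr) scale0r.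
Qed.

(** Bilinear extension of the relations between basis vectors; it is the polarised form of
    [v^2 = -|v|^2]. *)
Lemma clvec_anticomm v w : e v * e w + e w * e v = (- (dot v w *+ 2))%:A.
Proof.
rewrite !clvec_basis !mulr_suml.
under eq_bigr => i _ do rewrite mulr_sumr.
under [X in _ + X]eq_bigr => i _ do rewrite mulr_sumr.
rewrite [X in _ + X]exchange_big -big_split /=.
rewrite dotE -sumrMnl -sumrN scaler_suml.
apply: eq_bigr => i _; rewrite -big_split /=.
have E j : (v i 0 *: clbasis [set i]) * (w j 0 *: clbasis [set j]) +
    (w j 0 *: clbasis [set j]) * (v i 0 *: clbasis [set i]) =
    (v i 0 * w j 0 * - ((i == j)%:R *+ 2))%:A.
  rewrite -!scalerAl -!scalerAr !scalerA [w j 0 * _]mulrC -scalerDr.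
  by rewrite clbasis_anticomm scalerA.
rewrite (eq_bigr _ (fun j _ => E j)) (bigD1 i) //= big1 => [|j /negPf].
  by rewrite eqxx addr0 mulrN mulrnAr mulr1.
by rewrite eq_sym => ->; rewrite mul0rn oppr0 mulr0 scale0r.
Qed.

Lemma clvec_sqr v : e v * e v = (- dot v v)%:A.
Proof.
have /eqP := clvec_anticomm v v; rewrite -mulr2n -mulNrn -scalerMnl -subr_eq0.
rewrite -mulrnBl -scaler_nat scaler_eq0 pnatr_eq0 /= subr_eq0.
by move/eqP.
Qed.

(** For [i] in [A], testing against the basis vector [e_i] compares [x A] with its own negative, so
    every coefficient of positive degree vanishes. The twist by [clalpha] matters: in odd dimension
    the volume element is central in the untwisted sense. *)
Lemma clscalar_of_comm x :
  (forall v, clalpha x * e v = e v * x) -> x = (x set0)%:A.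
Proof.
move=> comm; apply/ffunP=> A; rewrite clscaleE ffunE.
have [->|/set0Pn[i iA]] := eqVneq A set0; first by rewrite mulr1.
have := comm (delta_mx i 0).
have -> : e (delta_mx i 0) = clbasis [set i].
  rewrite clvec_basis (bigD1 i) //= big1 => [|j /negPf ji].
    by rewrite mxE !eqxx scale1r addr0.
  by rewrite mxE ji scale0r.
(* At this coefficient only the term [x A] survives on either side. *)
move/ffunP/(_ (symdiff [set i] A)).
rewrite !clmulE (bigD1 A) //= big1 ?addr0 => [|B BA]; last first.
  rewrite [clbasis _ _]ffunE (_ : _ == _ = false) ?mulr0 //.
  apply/negbTE; apply: contra BA; rewrite eq_symdiff => /eqP.
  by rewrite (symdiffC B) => /(inv_inj (symdiffK [set i]))->.
rewrite (bigD1 [set i]) //= big1 ?addr0 => [|B /negPf Bi]; last first.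
  by rewrite [clbasis _ _]ffunE Bi mulr0 mul0r.
rewrite symdiffK (symdiffC [set i]) symdiffK !ffunE !eqxx !mulr1 mulr0.
move/(congr1 ( *%R (sgn A [set i]))).
rewrite !mulrA clsignM mul1r clsign_swap1 iA addn1 exprS -mulrA mulN1r.
set t := _ * x A => /eqP; rewrite -addr_eq0 -mulr2n mulrn_eq0 /= mulf_eq0.
by rewrite signr_eq0 => /eqP.
Qed.

Lemma clscalar_inj : injective (fun a : R => a%:A : Cl R m).
Proof. by move=> a b /ffunP/(_ set0); rewrite !clscaleE ffunE eqxx !mulr1. Qed.

End CliffordInvolutions.

(** * The Pin group *)

Section Pin.
Variables (R : realType) (m : nat).
Implicit Types (x y z : Cl R m) (v w u : 'cV[R]_m) (M N : 'M[R]_m).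
Local Notation e := (@clvec R m).

Lemma in_PinP x : in_Pin x <->
  exists (b : bool) (s : seq 'cV[R]_m),
    all (@unit_vec R m) s /\ x = (-1) ^+ b * \prod_(u <- s) e u.
Proof.
have E s : foldr (@clmul R m) (cl1 R m) (map e s) = \prod_(u <- s) e u.
  by elim: s => [|u s IH]; rewrite ?big_nil // big_cons -IH.
split=> -[b [s [us ->]]]; exists b, s; split => //; rewrite E.
  case: b; rewrite ?expr0 ?mul1r // expr1 mulN1r.
  by apply/ffunP=> A; rewrite !ffunE.
case: b; rewrite ?expr0 ?mul1r // expr1 mulN1r.
by apply/ffunP=> A; rewrite !ffunE.
Qed.

Lemma in_PinM x y : in_Pin x -> in_Pin y -> in_Pin (x * y).
Proof.
move=> /in_PinP[b [s [us ->]]] /in_PinP[c [t [ut ->]]]; apply/in_PinP.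
exists (b (+) c), (s ++ t); rewrite all_cat us; split => //.
by rewrite big_cat signr_addb /= !mulrA; congr (_ * _); rewrite -!mulrA commr_sign.
Qed.

Lemma in_PinN x : in_Pin x -> in_Pin (- x).
Proof.
move=> /in_PinP[b [s [us ->]]]; apply/in_PinP; exists (~~ b), s; split=> //.
by rewrite signrN mulNr.
Qed.

Lemma in_Pin1 : in_Pin (1 : Cl R m).
Proof. by apply/in_PinP; exists false, [::]; rewrite big_nil mulr1. Qed.

(** A unit vector has [clconj u * u = - u^2 = 1], and products telescope; thus [clconj] provides the
    inverse on Pin. *)
Lemma clconj_Pin x : in_Pin x -> clconj x * x = 1 /\ x * clconj x = 1.
Proof.
move=> /in_PinP[b [s [us ->]]].
have sgnP y : clconj y * y = 1 /\ y * clconj y = 1 ->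
   clconj ((-1) ^+ b * y) * ((-1) ^+ b * y) = 1 /\
   (-1) ^+ b * y * clconj ((-1) ^+ b * y) = 1.
  by case: b; rewrite ?expr0 ?mul1r // expr1 !mulN1r clconjN !mulrNN.
apply: sgnP; elim: s us => [|u s IH] /=; first by rewrite big_nil clconj1 mulr1.
case/andP=> /eqP uu /IH[IH1 IH2]; rewrite big_cons clconjM.
have uu1 : clconj (e u) * e u = 1 /\ e u * clconj (e u) = 1.
  by rewrite clconj_vec mulNr mulrN clvec_sqr /dot uu scaleNr scale1r opprK.
case: uu1 => u1 u2; split.
  by rewrite mulrA -(mulrA _ _ (e u)) u1 mulr1.
by rewrite mulrA -(mulrA (e u)) IH2 mulr1.
Qed.

(** Holds by conversion; it exposes the ring product in place of [clmul], so that ring lemmas can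
    rewrite. *)
Lemma rho_isP x M :
  rho_is x M <-> forall v, clalpha x * e v = e (M *m v) * x.
Proof. by []. Qed.

Lemma rho_isM x y M N : rho_is x M -> rho_is y N -> rho_is (x * y) (M *m N).
Proof.
move=> /rho_isP xM /rho_isP yN; apply/rho_isP=> v.
by rewrite clalphaM -mulrA yN mulrA xM mulmxA -mulrA.
Qed.

Lemma rho_isN x M : rho_is x M -> rho_is (- x) M.
Proof.
by move=> /rho_isP xM; apply/rho_isP=> v; rewrite clalphaN mulNr mulrN xM.
Qed.

Lemma rho_is1 : rho_is (1 : Cl R m) 1%:M.
Proof. by apply/rho_isP=> v; rewrite clalpha1 mul1mx mul1r mulr1. Qed.

Definition reflection u : 'M[R]_m := 1%:M - (u *m u^T) *+ 2.

Lemma reflectionE u v : reflection u *m v = v - (dot u v *+ 2) *: u.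
Proof.
rewrite mulmxBl mul1mx -scaler_nat -scalemxAl -mulmxA.
by rewrite [u^T *m v]mx11_scalar -/(dot u v) mul_mx_scalar scalerA mulr_natl.
Qed.

(** Anticommutation gives [- u v = v u + 2 (u . v)], and the last term equals [- 2 (u . v) u * u]
    because [u^2 = -1]. *)
Lemma rho_is_vec u : dot u u = 1 -> rho_is (e u) (reflection u).
Proof.
move=> uu; apply/rho_isP=> v; rewrite clalpha_vec reflectionE clvecD.
rewrite -scaleNr clvecZ mulrDl -scalerAl clvec_sqr uu scalerA mulrN1 opprK.
have := clvec_anticomm u v; rewrite scaleNr => /eqP; rewrite -subr_eq0 opprK.
move=> /eqP E; apply/eqP; rewrite eq_sym mulNr -subr_eq0 opprK -E.
by apply/eqP; rewrite addrC addrA.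
Qed.

(* Elements of [Pin] over the same orthogonal matrix differ by an element commuting in
   the twisted sense with every vector, hence by a scalar, of square 1. *)
Lemma Pin_fiber x y M :
  in_Pin x -> in_Pin y -> rho_is x M -> rho_is y M -> y = x \/ y = - x.
Proof.
move=> xP yP /rho_isP xM /rho_isP yM.
have [xx xx'] := clconj_Pin xP; have [yy yy'] := clconj_Pin yP.
have ax : clalpha (clconj x) * clalpha x = 1 by rewrite -clalphaM xx clalpha1.
pose z := clconj x * y.
have zz : clconj z * z = 1.
  by rewrite clconjM clconjK mulrA -(mulrA _ x) xx' mulr1.
have yE : y = x * z by rewrite mulrA xx' mul1r.
have /clscalar_of_comm zE : forall v, clalpha z * e v = e v * z.
  move=> v; rewrite [LHS](_ : _ = clalpha (clconj x) * (e (M *m v) * x) * z).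
    by rewrite -xM mulrA ax mul1r.
  by rewrite clalphaM -!mulrA -yE yM.
move: zz; rewrite zE clconjZ clconj1 -scalerAl mul1r scalerA -[RHS]scale1r.
move/clscalar_inj/eqP; rewrite -expr2 sqrf_eq1 => /orP[]/eqP c1; move: yE.
  by rewrite zE c1 scale1r mulr1; left.
by rewrite zE c1 scaleN1r mulrN mulr1; right.
Qed.

Lemma Pin_neq0 x : in_Pin x -> x != 0.
Proof.
case/clconj_Pin=> xx _; apply/eqP=> x0; move: xx; rewrite x0 mulr0.
by move/eqP; rewrite eq_sym oner_eq0.
Qed.

Lemma Pin_neqN x : in_Pin x -> x != - x.
Proof.
move=> /Pin_neq0; apply: contra; rewrite -addr_eq0 -mulr2n -scaler_nat.
by rewrite scaler_eq0 pnatr_eq0.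
Qed.

End Pin.

(** * Involutions in the orthogonal group and their lifts *)

Section OrthogonalInvolutions.
Variables (R : realType) (m : nat).
Implicit Types (x : Cl R m) (v w u : 'cV[R]_m) (M P : 'M[R]_m) (s : seq 'cV[R]_m).
Local Notation e := (@clvec R m).

Definition orthonormal s : bool :=
  all (@unit_vec R m) s && pairwise (fun u v => dot u v == 0) s.

Lemma dotZl a v w : dot (a *: v) w = a * dot v w.
Proof. by rewrite !dotE mulr_sumr; apply: eq_bigr => i _; rewrite mxE mulrA. Qed.

Lemma dot_gt0 v : v != 0 -> 0 < dot v v.
Proof.
move=> v0; rewrite dotE lt_neqAle sumr_ge0 => [|i _]; last exact: sqr_ge0.
rewrite andbT eq_sym psumr_eq0 => [|i _]; last exact: sqr_ge0.
apply: contra v0 => /allP v0; apply/eqP/matrixP=> i j; rewrite ord1 mxE.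
by have := v0 i (mem_index_enum _); rewrite -expr2 sqrf_eq0 => /eqP.
Qed.

Lemma symproj_trace_ge0 P : P^T = P -> P *m P = P -> 0 <= \tr P.
Proof.
move=> PT PP; rewrite -PP -{1}PT; apply: sumr_ge0 => i _.
by rewrite mxE sumr_ge0 // => j _; rewrite mxE sqr_ge0.
Qed.

(** Peel off a unit vector [u] of the image: [P - u u^T] is again a symmetric projection, of trace
    one less. Nonnegativity of the trace makes this stop. *)
Lemma symproj_decomposition P : P^T = P -> P *m P = P ->
  exists s, [/\ orthonormal s, (size s)%:R = \tr P & P = \sum_(u <- s) u *m u^T].
Proof.
move=> PT PP.
(* The extra clause that [P] fixes every chosen vector is needed in the induction to make [u]
   orthogonal to the later ones. *)
suff [s [ons sz PE _]] : exists s, [/\ orthonormal s, (size s)%:R = \tr P,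
    P = \sum_(u <- s) u *m u^T & {in s, forall u, P *m u = u}] by exists s.
(* The trace is not yet known to be an integer, so the induction runs on a natural number strictly
   above it. *)
have := truncnS_gt (\tr P); move: (Num.truncn _).+1 => k.
elim: k P PT PP => [|k IH] P PT PP trk.
  by have := symproj_trace_ge0 PT PP; rewrite leNgt trk.
have [->|P0] := eqVneq P 0.
  by exists [::]; rewrite big_nil linear0.
have [j vj] : exists j, col j P != 0.
  apply/existsP; apply: contraR P0 => /existsPn P0; apply/eqP/matrixP=> i j.
  by have /negPn/eqP/matrixP/(_ i 0) := P0 j; rewrite !mxE.
(* A column of [P] lies in its image, hence is fixed by [P]. *)
pose v := col j P; pose u := (Num.sqrt (dot v v))^-1 *: v.
have vv := dot_gt0 vj.
have Pu : P *m u = u.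
  by rewrite -scalemxAr; congr (_ *: _); rewrite /v colE mulmxA PP.
have uu : dot u u = 1.
  rewrite dotZl dotC dotZl mulrA -invfM.
  by rewrite -expr2 sqr_sqrtr ?mulVf ?gt_eqF // ltW.
have uTu : u^T *m u = 1%:M by rewrite [LHS]mx11_scalar -/(dot u u) uu.
have uP : u^T *m P = u^T by rewrite -[in LHS]PT -trmx_mul Pu.
pose Q := P - u *m u^T.
have Qu : Q *m u = 0 by rewrite mulmxBl Pu -mulmxA uTu mulmx1 subrr.
have QT : Q^T = Q by rewrite linearB /= trmx_mul trmxK PT.
have QQ : Q *m Q = Q.
  by rewrite {2}/Q mulmxBr mulmxA Qu mul0mx subr0 mulmxBl PP -mulmxA uP.
have trQ : \tr Q = \tr P - 1.
  by rewrite linearB /= mxtrace_mulC trace_mx11 -/(dot u u) uu.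
have [|s [/andP[us os] sz QE Qs]] := IH Q QT QQ.
  by rewrite trQ ltrBlDr -natr1 in trk *.
exists (u :: s); split.
- rewrite /orthonormal /= us os /unit_vec -/(dot u u) uu eqxx !andbT /=.
  apply/allP=> w ws; rewrite /dot -(Qs w ws) mulmxA -QT -trmx_mul Qu.
  by rewrite linear0 mul0mx mxE.
- by rewrite /= -natr1 sz trQ subrK.
- by rewrite big_cons -QE addrC subrK.
move=> w; rewrite inE => /predU1P[->//|ws].
rewrite -[RHS](Qs w ws) mulmxBl -mulmxA (_ : u^T *m w = 0) ?mulmx0 ?subr0 //.
by rewrite -(Qs w ws) mulmxA -QT -trmx_mul Qu linear0 mul0mx.
Qed.

(** The reflections multiply without cross terms, since [u u^T w w^T = 0] for orthogonal [u] and
    [w]. *)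
Lemma rho_is_orthonormal s : orthonormal s ->
  rho_is (\prod_(u <- s) e u) (1%:M - (\sum_(u <- s) u *m u^T) *+ 2).
Proof.
elim: s => [|u s IH]; first by move=> _; rewrite !big_nil mul0rn subr0; exact: rho_is1.
case/andP=> /= /andP[/eqP uu us] /andP[/allP os ps].
have {}IH := IH (introT andP (conj us ps)).
have := rho_isM (rho_is_vec uu) IH; rewrite !big_cons.
have z : u *m u^T *m (\sum_(w <- s) w *m w^T) = 0.
  rewrite mulmx_sumr big_seq big1 // => w /os /eqP uw.
  by rewrite mulmxA -[u *m _ *m w]mulmxA [u^T *m w]mx11_scalar -/(dot u w) uw
    raddf0 mulmx0 mul0mx.
rewrite /reflection mulmxBl mul1mx mulmxBr mulmx1 -!scaler_nat -scalemxAr.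
by rewrite -scalemxAl z !scaler0 subr0 scalerDr opprD addrAC addrA.
Qed.

Lemma clvec_prod_comm u s : all (fun w => dot u w == 0) s ->
  (\prod_(w <- s) e w) * e u = (-1) ^+ size s * (e u * \prod_(w <- s) e w).
Proof.
elim: s => [|w s IH] /=; first by rewrite big_nil mulr1 !mul1r.
case/andP=> /eqP uw /IH {}IH; rewrite big_cons -mulrA IH exprS.
have := clvec_anticomm u w; rewrite uw mul0rn oppr0 scale0r => /eqP.
rewrite addr_eq0 => /eqP E.
rewrite [e u * (_ * _)]mulrA E mulN1r !(mulNr, mulrN) opprK.
by rewrite [LHS]mulrA commr_sign -!mulrA.
Qed.

(** Moving the second copy of the first vector past the [size s] others costs one sign each, and its
    square costs one more; these exponents add up to the triangular number d(d+1)/2. *)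
Lemma clvec_prod_sqr s : orthonormal s ->
  (\prod_(u <- s) e u) * (\prod_(u <- s) e u) = (-1) ^+ 'C((size s).+1, 2).
Proof.
elim: s => [|u s IH]; first by rewrite big_nil mulr1.
case/andP=> /= /andP[/eqP uu us] /andP[os ps].
rewrite big_cons mulrA -[e u * _ * e u]mulrA (clvec_prod_comm os).
rewrite [e u * (_ * _)]mulrA commr_sign -!mulrA [e u * (e u * _)]mulrA.
rewrite clvec_sqr [dot _ _]uu scaleN1r mulN1r mulrN IH ?/orthonormal ?us //.
have -> : 'C((size s).+2, 2) = (size s + 'C((size s).+1, 2)).+1.
  by rewrite binS bin1 addnS addnC.
by rewrite exprS exprD mulN1r.
Qed.

Lemma clvec_prod_alpha s :
  clalpha (\prod_(u <- s) e u) = (-1) ^+ size s * \prod_(u <- s) e u.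
Proof.
elim: s => [|u s IH]; first by rewrite big_nil clalpha1 mulr1.
by rewrite !big_cons clalphaM IH clalpha_vec exprS mulN1r !mulNr [in LHS]mulrA commr_sign mulrA.
Qed.

(** An orthogonal involution is symmetric, so [(1 - M) / 2] is the projection onto the
    (-1)-eigenspace, and [g] is its rank. The square and the parity agree for [x] and [- x], hence
    are stated for every lift. *)
Lemma Pin_involution M : M^T *m M = 1%:M -> M *m M = 1%:M ->
  exists g : nat, g%:R = (m%:R - \tr M) / 2 /\
  (exists2 x, in_Pin x & rho_is x M) /\
  forall x, in_Pin x -> rho_is x M ->
    x * x = (-1) ^+ 'C(g.+1, 2) /\ clalpha x = (-1) ^+ g * x.
Proof.
move=> MTM MM.
have MT : M^T = M by rewrite -[LHS]mulmx1 -MM mulmxA MTM mul1mx.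
pose P : 'M[R]_m := 2^-1 *: (1%:M - M).
have PT : P^T = P by rewrite linearZ /= linearB /= trmx1 MT.
have PP : P *m P = P.
  rewrite -scalemxAl -scalemxAr scalerA mulmxBl mul1mx mulmxBr mulmx1 MM opprB.
  rewrite [_ + _](_ : _ = 2 *: (1%:M - M)) ?scalerA; last first.
    by rewrite scaler_nat mulr2n.
  by rewrite -mulrA mulVf ?mulr1 // pnatr_eq0.
have [s [ons sz PE]] := symproj_decomposition PT PP.
exists (size s); split; first by rewrite sz linearZ linearB /= mxtrace1 mulrC.
pose t := \prod_(u <- s) e u.
have tP : in_Pin t by apply/in_PinP; exists false, s; rewrite mul1r; case/andP: ons.
have tM : rho_is t M.
  rewrite (_ : M = 1%:M - (\sum_(u <- s) u *m u^T) *+ 2).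
    exact: rho_is_orthonormal.
  by rewrite -PE -scaler_nat scalerA mulfV ?pnatr_eq0 // scale1r opprB addrC subrK.
split=> [|x xP xM]; first by exists t.
have [|] := Pin_fiber tP xP tM xM => ->.
  by rewrite clvec_prod_sqr // clvec_prod_alpha.
by rewrite mulrNN clvec_prod_sqr // clalphaN clvec_prod_alpha mulrN.
Qed.

End OrthogonalInvolutions.

(** Source of the condition 0 or 3 modulo 4: these are the dimensions for which the lifts of an
    involution square to 1. *)
Lemma odd_bin2S g : odd 'C(g.+1, 2) = (g %% 4 \in [:: 1; 2])%N.
Proof.
have := mul_bin_diag g.+1 1; rewrite bin1 /=.
move: 'C(g.+1, 2) => c; rewrite (divn_eq g 4); move: (g %/ 4)%N => q.
have : (g %% 4 < 4)%N by rewrite ltn_mod.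
rewrite modnMDl modn_mod.
case: (g %% 4)%N => [|[|[|[|//]]]] _ /= E; rewrite !inE /=; nia.
Qed.

(** * The Coxeter presentation of the symmetric group *)

Section AdjacentTranspositions.
Variable n : nat.
Implicit Types (i j : nat) (x a b : 'I_n).
Local Notation s := (adj_tr n).

Lemma adj_trE i a b : (0 < i)%N -> val a = i.-1 -> val b = i -> s i = tperm a b.
Proof.
move=> i0 ai bi; rewrite /adj_tr.
case: insubP => [a' _ a'i|/negP[]]; last by rewrite -ai; apply: ltn_ord.
case: insubP => [b' _ b'i|/negP[]]; last by rewrite -bi; apply: ltn_ord.
by congr tperm; apply: val_inj; rewrite /= ?a'i ?b'i.
Qed.

Lemma adj_tr_exists i : (0 < i < n)%N ->
  exists a b, [/\ val a = i.-1, val b = i & s i = tperm a b].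
Proof.
case/andP=> i0 iltn; have i'n := leq_ltn_trans (leq_pred i) iltn.
by exists (Ordinal i'n), (Ordinal iltn); split => //; apply: adj_trE.
Qed.

Lemma adj_tr_val i x : (0 < i < n)%N ->
  s i x = (if x == i :> nat then i.-1 else if x == i.-1 :> nat then i else x) :> nat.
Proof.
move=> iltn; have [a [b [ai bi ->]]] := adj_tr_exists iltn.
move: iltn; rewrite -ai -bi; case: tpermP => [->|->|/eqP + /eqP]; rewrite -?val_eqE /=.
- by repeat case: eqP; lia.
- by repeat case: eqP; lia.
by repeat case: eqP.
Qed.

Lemma adj_tr_sqr i : (s i * s i = 1)%g.
Proof.
rewrite /adj_tr; case: (@insub nat _ 'I_n i.-1) => [a|]; last by rewrite mulg1.
by case: (@insub nat _ 'I_n i) => [b|]; rewrite ?mulg1 ?tperm2.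
Qed.

Lemma adj_tr_far i j : (0 < i)%N -> (i.+1 < j < n)%N -> (s i * s j = s j * s i)%g.
Proof.
move=> i0 ijn; have [|a [b [ai bi ->]]] := @adj_tr_exists i; first lia.
have [|c [d [cj dj ->]]] := @adj_tr_exists j; first lia.
rewrite conjgC tpermJ !tpermD // -val_eqE /= ?ai ?bi ?cj ?dj; lia.
Qed.

(** Both sides are conjugates of a transposition by a transposition, and both equal the
    transposition exchanging the two outer points. *)
Lemma adj_tr_braid i : (0 < i)%N -> (i.+1 < n)%N ->
  (s i * s i.+1 * s i = s i.+1 * s i * s i.+1)%g.
Proof.
move=> i0 ijn; have [|a [b [ai bi iE]]] := @adj_tr_exists i; first lia.
have jE : s i.+1 = tperm b (Ordinal ijn) by apply: adj_trE.
have tJ (x y : 'I_n) g : (tperm x y * g * tperm x y = g ^ tperm x y)%g.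
  by rewrite conjgE tpermV mulgA.
rewrite iE jE !tJ !tpermJ.
rewrite tpermR tpermL !tpermD // -val_eqE /= ?ai ?bi; lia.
Qed.

End AdjacentTranspositions.

(** * Families satisfying the Coxeter relations extend to the symmetric group *)

Section CoxeterPresentation.
Variables (n : nat) (A : nzRingType) (t : nat -> A).
Hypothesis t_sqr : forall i, (0 < i < n)%N -> t i * t i = 1.
Hypothesis t_far : forall i j, (0 < i)%N -> (i.+1 < j < n)%N -> t i * t j = t j * t i.
Hypothesis t_braid : forall i, (0 < i)%N -> (i.+1 < n)%N ->
  t i * t i.+1 * t i = t i.+1 * t i * t i.+1.
Implicit Types (i j k r : nat) (w p q : seq nat).
Local Notation s := (adj_tr n).

Definition word_perm w : 'S_n := (\prod_(i <- w) s i)%g.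
Definition word_ring w : A := \prod_(i <- w) t i.
(** Both evaluations are tracked at once, so that each rewriting of words is valid in ['S_n] and in
    [A] together. *)
Definition word_eqv w p := word_perm w = word_perm p /\ word_ring w = word_ring p.
Definition letters r w := all (fun i => 0 < i <= r)%N w.

Lemma word_perm_cat w p : word_perm (w ++ p) = (word_perm w * word_perm p)%g.
Proof. exact: big_cat. Qed.

Lemma word_ring_cat w p : word_ring (w ++ p) = word_ring w * word_ring p.
Proof. exact: big_cat. Qed.

Lemma word_eqv_trans w p q : word_eqv w p -> word_eqv p q -> word_eqv w q.
Proof. by case=> e1 e2 [e3 e4]; split; rewrite ?e1 ?e2. Qed.

Lemma word_eqv_cat w w' p p' :
  word_eqv w w' -> word_eqv p p' -> word_eqv (w ++ p) (w' ++ p').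
Proof.
by case=> e1 e2 [e3 e4]; split; rewrite ?word_perm_cat ?word_ring_cat ?e1 ?e2 ?e3 ?e4.
Qed.

Lemma word_eqv_sqr i : (0 < i < n)%N -> word_eqv [:: i; i] [::].
Proof.
move=> iltn; split; rewrite /word_perm /word_ring big_nil !big_cons big_nil.
  by rewrite mulg1 adj_tr_sqr.
by rewrite mulr1 t_sqr.
Qed.

Lemma word_eqv_far i w : (0 < i < n)%N ->
  all (fun j => (0 < j < n) && ((i.+1 < j) || (j.+1 < i)))%N w ->
  word_eqv (w ++ [:: i]) (i :: w).
Proof.
move=> iltn; elim: w => [|j w IH] //= /andP[/andP[jn ij] /IH[e1 e2]].
have [c1 c2] : (s j * s i = s i * s j)%g /\ t j * t i = t i * t j.
  case/orP: ij => ij.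
    by split; symmetry; [apply: adj_tr_far | apply: t_far]; lia.
  by split; [apply: adj_tr_far | apply: t_far]; lia.
move: e1 e2; rewrite /word_eqv /word_perm /word_ring !big_cons => -> ->.
by rewrite mulgA c1 -mulgA mulrA c2 -mulrA.
Qed.

Lemma word_eqv_braid i : (0 < i)%N -> (i.+1 < n)%N ->
  word_eqv [:: i.+1; i; i.+1] [:: i; i.+1; i].
Proof.
move=> i0 iltn; split; rewrite /word_perm /word_ring !big_cons big_nil.
  by rewrite !mulg1 !mulgA adj_tr_braid.
by rewrite !mulr1 !mulrA t_braid.
Qed.

(* The word of [s_r s_(r-1) ... s_(k+1)], the coset representative of S_r in S_(r+1)
   moving the last point [r] to [k]. *)
Definition descent r k : seq nat := rev (iota k.+1 (r - k)).

Lemma descent_cat r j k : (k <= j <= r)%N -> descent r k = descent r j ++ descent j k.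
Proof.
case/andP=> kj jr; rewrite /descent -rev_cat; congr rev.
rewrite (_ : r - k = (j - k) + (r - j))%N; last lia.
by rewrite iotaD; congr (_ ++ iota _ _); lia.
Qed.

Lemma descentS k : descent k.+1 k = [:: k.+1].
Proof. by rewrite /descent subSn // subnn. Qed.

Lemma descent_id k : descent k k = [::].
Proof. by rewrite /descent subnn. Qed.

Lemma mem_descent r k i : (i \in descent r k) = (k < i <= r)%N.
Proof. by rewrite mem_rev mem_iota; lia. Qed.

(** Appending a generator to a coset representative either lengthens it ([i = k]), shortens it
    ([i = k.+1]), or lets a smaller generator come out on the left: [i] itself if [i < k], and
    [i.-1] by a braid move if [i > k.+1]. *)
Lemma descent_rcons r k i : (r < n)%N -> (k <= r)%N -> (0 < i <= r)%N ->
  exists p k', [/\ letters r.-1 p, (k' <= r)%N &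
    word_eqv (descent r k ++ [:: i]) (p ++ descent r k')].
Proof.
move=> rn kr ir; have [ik|ik|ik] := ltngtP i k.
- exists [:: i], k; split => //; first by rewrite /letters /=; lia.
  apply: word_eqv_far; first lia.
  by apply/allP=> j; rewrite mem_descent; lia.
- have [->|ik1] := eqVneq i k.+1.
    exists [::], k.+1; split => //; first lia.
    rewrite (@descent_cat r k.+1 k) ?descentS; last lia.
    rewrite -catA -[X in word_eqv _ X]cats0 /=.
    by apply: word_eqv_cat => //; apply: word_eqv_sqr; lia.
  have [j iE] : exists j, i = j.+2 by exists i.-2; lia.
  move: iE ir ik ik1 => {i}-> ir ik ik1; move: j ir ik ik1 => i ir ik ik1.
  (* From here the appended letter is [i.+2]. It commutes left past [descent i k], a braid move
     turns it into [i.+1], and that commutes past [descent r i.+2]. *)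
  exists [:: i.+1], k; split => //; first by rewrite /letters /=; lia.
  rewrite (@descent_cat r i.+2 k) ?(@descent_cat i.+2 i.+1 k) ?(@descent_cat i.+1 i k); try lia.
  rewrite !descentS -!catA.
  apply: (@word_eqv_trans _ (descent r i.+2 ++ ([:: i.+2; i.+1; i.+2] ++ descent i k))).
    apply: word_eqv_cat => //.
    have cat2 := @word_eqv_cat [:: i.+2; i.+1] [:: i.+2; i.+1].
    apply: cat2 => //; apply: word_eqv_far; first lia.
    by apply/allP=> j; rewrite mem_descent; lia.
  apply: (@word_eqv_trans _ (descent r i.+2 ++ [:: i.+1; i.+2; i.+1] ++ descent i k)).
    apply: word_eqv_cat => //; apply: word_eqv_cat => //.
    by apply: word_eqv_braid; lia.
  rewrite [X in word_eqv X _](_ : _ =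
    (descent r i.+2 ++ [:: i.+1]) ++ ([:: i.+2; i.+1] ++ descent i k)); last by rewrite -catA.
  rewrite [X in word_eqv _ X](_ : _ =
    (i.+1 :: descent r i.+2) ++ ([:: i.+2; i.+1] ++ descent i k)) //.
  apply: word_eqv_cat => //; apply: word_eqv_far; first lia.
  by apply/allP=> j; rewrite mem_descent; lia.
subst k; case: i ir kr => [|i] // ir kr; exists [::], i; split => //; first lia.
by rewrite (@descent_cat r i.+1 i) ?descentS //; lia.
Qed.

Lemma word_normal_form r w : (r < n)%N -> letters r w ->
  exists p k, [/\ letters r.-1 p, (k <= r)%N & word_eqv w (p ++ descent r k)].
Proof.
move=> rn; elim/last_ind: w => [|w i IH].
  by exists [::], r; rewrite descent_id.
rewrite /letters all_rcons => /andP[ir /IH[p [k [pr kr e]]]].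
have [p' [k' [p'r k'r e']]] := descent_rcons rn kr ir.
exists (p ++ p'), k'; split => //; first by rewrite /letters all_cat; apply/andP.
rewrite -cats1; apply: (@word_eqv_trans _ ((p ++ descent r k) ++ [:: i])).
  exact: word_eqv_cat.
by rewrite -!catA; apply: word_eqv_cat.
Qed.

Lemma word_perm_cons i w x : word_perm (i :: w) x = word_perm w (s i x).
Proof. by rewrite /word_perm big_cons permM. Qed.

Lemma word_perm_fix r w (x : 'I_n) : letters r w -> (r < x)%N -> word_perm w x = x.
Proof.
elim: w => [|i w IH] /=; first by rewrite /word_perm big_nil perm1.
case/andP=> ir wr rx; rewrite word_perm_cons (_ : s i x = x) ?IH //.
have := ltn_ord x; move=> xn; apply: val_inj; rewrite /= adj_tr_val; last lia.
by repeat case: eqP; lia.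
Qed.

Lemma word_perm_descent r k (x : 'I_n) : (k <= r)%N -> x = r :> nat ->
  word_perm (descent r k) x = k :> nat.
Proof.
elim: r x => [|r IH] x kr xr.
  by rewrite /word_perm (_ : k = 0%N) ?big_nil ?perm1 //; lia.
have [->|kr1] := eqVneq k r.+1; first by rewrite descent_id /word_perm big_nil perm1.
rewrite (@descent_cat r.+1 r k) ?descentS ?word_perm_cons; last lia.
have := ltn_ord x; move=> xn; apply: IH; first lia.
by rewrite adj_tr_val ?xr ?eqxx; lia.
Qed.

Lemma letters0 w : letters 0 w -> w = [::].
Proof. by case: w => //= -[|i] w. Qed.

(** In normal form the image of the point [r] determines the coset representative. Cancelling it in
    the group leaves words in fewer generators, to which induction applies. *)
Lemma word_ring_perm r w w' : (r < n)%N -> letters r w -> letters r w' ->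
  word_perm w = word_perm w' -> word_ring w = word_ring w'.
Proof.
elim: r w w' => [|r IH] w w' rn; first by move=> /letters0-> /letters0->.
move=> /(word_normal_form rn)[p [k [pr kr [e1 e2]]]].
move=> /(word_normal_form rn)[p' [k' [p'r k'r [e1' e2']]]].
rewrite e1 e2 e1' e2' !word_perm_cat !word_ring_cat => E.
have kk' : k = k'.
  have /(congr1 (@nat_of_ord n)) := congr1 (fun g : 'S_n => g (Ordinal rn)) E.
  by rewrite !permM (word_perm_fix pr) // (word_perm_fix p'r) // !word_perm_descent.
by move: E; rewrite kk' => /mulIg /(IH _ _ (ltnW rn) pr p'r) ->.
Qed.

(** Dividing by the descent that sends the last moved point to its image under [g] leaves a
    permutation fixing that point as well. *)
Lemma word_perm_onto r (g : 'S_n) : (r < n)%N ->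
  (forall x : 'I_n, (r < x)%N -> g x = x) -> exists2 w, letters r w & word_perm w = g.
Proof.
elim: r g => [|r IH] g rn gfix.
  exists [::] => //; rewrite /word_perm big_nil; apply/permP=> x; rewrite perm1.
  have [x0|] := posnP x; last by move/gfix.
  have [gx0|/gfix/perm_inj //] := posnP (g x).
  by apply: val_inj; rewrite /= x0 gx0.
pose x := Ordinal rn; have gx : (g x <= r.+1)%N.
  by rewrite leqNgt; apply/negP=> /[dup] /gfix/perm_inj ->; rewrite ltnn.
pose d := word_perm (descent r.+1 (g x)).
have dx : d x = g x by apply: val_inj; apply: word_perm_descent.
have dfix (y : 'I_n) : (r.+1 < y)%N -> d y = y.
  apply: word_perm_fix; apply/allP=> i; rewrite mem_descent; lia.
have [y ry|w wr wE] := IH (g * d^-1)%g (ltnW rn).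
  rewrite permM; apply: (@perm_inj _ d); rewrite permKV.
  have [yx|yx] := eqVneq y x; first by rewrite yx dx.
  have ry1 : (r.+1 < y)%N.
    by move: yx; rewrite -val_eqE /=; lia.
  by rewrite gfix ?dfix.
exists (w ++ descent r.+1 (g x)); last by rewrite word_perm_cat wE mulgKV.
rewrite /letters all_cat; apply/andP; split.
  by apply: sub_all wr => i; lia.
by apply/allP=> i; rewrite mem_descent; lia.
Qed.

(** Choose a word for each permutation; multiplicativity holds because the ring value depends only
    on the permutation. The word is kept in the conclusion so that properties of the generators can
    be carried to [L] by induction. *)
Lemma coxeter_extension : exists L : 'S_n -> A,
  [/\ forall g h, L (g * h)%g = L g * L h &
      forall g, exists w, [/\ all (fun i => 0 < i < n)%N w,
        g = word_perm w & L g = word_ring w]].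
Proof.
(* For [n = 0] the bound [n.-1 < n] fails, and the group is trivial. *)
have [n0|n0] := posnP n.
  exists (fun=> 1); split=> [g h|g]; first by rewrite mulr1.
  exists [::]; rewrite /word_perm /word_ring !big_nil; split => //.
  by apply/permP=> x; have := ltn_ord x; rewrite {2}n0.
have n1 : (n.-1 < n)%N by lia.
have onto g : exists w, letters n.-1 w && (word_perm w == g).
  have [x|w lw <-] := @word_perm_onto n.-1 g n1; last by exists w; rewrite lw eqxx.
  by have := ltn_ord x; lia.
pose W g := xchoose (onto g).
have WP g : letters n.-1 (W g) /\ word_perm (W g) = g.
  by have /andP[lw /eqP] := xchooseP (onto g).
exists (fun g => word_ring (W g)); split=> [g h|g].
  rewrite -word_ring_cat; apply: (@word_ring_perm n.-1) => //; try by case: (WP (g * h)%g).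
    by rewrite /letters all_cat; apply/andP; split; case: (WP g); case: (WP h).
  by rewrite word_perm_cat !(WP _).2.
exists (W g); split; rewrite ?(WP _).2 //.
by apply: sub_all (WP g).1 => i; lia.
Qed.

End CoxeterPresentation.

(** * Lifts of representations *)

(** The symmetric group is transitive on sequences of distinct points: a permutation correct on the
    tail is corrected at the head by a transposition avoiding the tail of [s']. This yields the
    conjugacies below. *)
Lemma exists_perm_map (T : finType) (s s' : seq T) :
  uniq s -> uniq s' -> size s = size s' -> exists g : {perm T}, map g s = s'.
Proof.
elim: s s' => [|x s IH] [|x' s'] //=; first by exists 1%g.
case/andP=> xs us /andP[xs' us'] [/IH[]// g gs].
exists (g * tperm (g x) x')%g; rewrite permM tpermL; congr (_ :: _).
rewrite -[RHS]gs; apply/eq_in_map=> y ys; rewrite permM tpermD //.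
  by apply: contraNneq xs => /perm_inj ->.
by apply: contraNneq xs' => ->; rewrite -gs map_f.
Qed.

Lemma tperm_conj_adj_tr n (a b : 'I_n) i : a != b -> (0 < i < n)%N ->
  exists w, tperm a b = (adj_tr n i ^ w)%g.
Proof.
move=> ab iltn; have /adj_tr_exists[c [d [ci di ->]]] := iltn.
have [|||w [wc wd]] := @exists_perm_map _ [:: c; d] [:: a; b] => //=.
- by rewrite inE andbT -val_eqE /= ci di; lia.
- by rewrite inE ab.
by exists w; rewrite tpermJ wc wd.
Qed.

Lemma adj_tr_conj n i j : (0 < i < n)%N -> (0 < j < n)%N ->
  exists w, adj_tr n i = (adj_tr n j ^ w)%g.
Proof.
move=> i0 j0; have [a [b [ai bi ->]]] := adj_tr_exists i0.
by apply: tperm_conj_adj_tr => //; rewrite -val_eqE /= ai bi; lia.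
Qed.

Lemma adj_tr_pair_conj n i j k l : (0 < i)%N -> (i.+1 < j < n)%N ->
  (0 < k)%N -> (k.+1 < l < n)%N ->
  exists w, (adj_tr n i * adj_tr n j = (adj_tr n k * adj_tr n l) ^ w)%g.
Proof.
move=> i0 ij k0 kl.
have [|a1 [b1 [a1i b1i ->]]] := @adj_tr_exists n i; first lia.
have [|a2 [b2 [a2i b2i ->]]] := @adj_tr_exists n j; first lia.
have [|a3 [b3 [a3i b3i ->]]] := @adj_tr_exists n k; first lia.
have [|a4 [b4 [a4i b4i ->]]] := @adj_tr_exists n l; first lia.
have [||//|w [w1 w2 w3 w4]] :=
  @exists_perm_map _ [:: a3; b3; a4; b4] [:: a1; b1; a2; b2].
- by rewrite /= !inE -!val_eqE /= a3i b3i a4i b4i; lia.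
- by rewrite /= !inE -!val_eqE /= a1i b1i a2i b2i; lia.
by exists w; rewrite conjMg !tpermJ w1 w2 w3 w4.
Qed.

Section CliffordSigns.
Variables (R : realType) (m : nat).
Implicit Types (x y : Cl R m).

Lemma cl_sign_eq1 c : ((-1) ^+ c == 1 :> Cl R m) = ~~ odd c.
Proof.
rewrite -signr_odd; case: (odd c); rewrite ?expr0 ?eqxx // expr1 eq_sym.
exact/negbTE/(Pin_neqN (@in_Pin1 R m)).
Qed.

Lemma Pin_regl x y z : in_Pin x -> x * y = x * z -> y = z.
Proof.
case/clconj_Pin=> xx _ /(congr1 ( *%R (clconj x))).
by rewrite !mulrA xx !mul1r.
Qed.

End CliffordSigns.

Section LiftsOfRepresentations.
Variables (R : realType) (gT : finGroupType) (m : nat) (pi : gT -> 'M[R]_m).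
Hypothesis pi_rep : real_rep pi.
Implicit Types (g h : gT) (x y : Cl R m).

Definition lifts x g := in_Pin x /\ rho_is x (pi g).

Lemma rep1 : pi 1%g = 1%:M.
Proof. by case: pi_rep => -[]. Qed.

Lemma repM g h : pi (g * h)%g = pi g *m pi h.
Proof. by case: pi_rep => -[_ piM] _; rewrite piM ?inE. Qed.

Lemma characterJ g h : character pi (g ^ h)%g = character pi g.
Proof.
by rewrite /character conjgE !repM mxtrace_mulC -mulmxA -repM mulgV rep1 mulmx1.
Qed.

Lemma character1 : character pi 1%g = m%:R.
Proof. by rewrite /character rep1 mxtrace1. Qed.

Lemma lifts1 : lifts 1 1%g.
Proof. by split; rewrite ?rep1; [apply: in_Pin1 | apply: rho_is1]. Qed.

Lemma liftsM x y g h : lifts x g -> lifts y h -> lifts (x * y) (g * h)%g.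
Proof.
by move=> [xP xg] [yP yh]; split; rewrite ?repM; [apply: in_PinM | apply: rho_isM].
Qed.

Lemma liftsN x g : lifts x g -> lifts (- x) g.
Proof. by case=> xP xg; split; [apply: in_PinN | apply: rho_isN]. Qed.

Lemma lifts_fiber x y g : lifts x g -> lifts y g -> y = x \/ y = - x.
Proof. by move=> [xP xg] [yP yg]; apply: Pin_fiber xg yg. Qed.

Lemma lifts_involution g : (g * g = 1)%g -> exists d : nat,
  [/\ d%:R = (character pi 1%g - character pi g) / 2,
      exists x, lifts x g &
      forall x, lifts x g -> x * x = (-1) ^+ 'C(d.+1, 2) /\ clalpha x = (-1) ^+ d * x].
Proof.
move=> gg; have MM : pi g *m pi g = 1%:M by rewrite -repM gg rep1.
have [d [dE [[x xP xg] dP]]] := Pin_involution (pi_rep.2 g) MM.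
exists d; split; first by rewrite character1.
  by exists x.
by move=> y [yP yg]; apply: dP.
Qed.

Lemma is_lift1 L : is_lift pi L -> L 1%g = 1.
Proof.
case=> LM LP _; apply: (@Pin_regl _ _ (L 1%g)) => //.
by rewrite mulr1 -[LHS]/(clmul _ _) -LM mulg1.
Qed.

Lemma is_lift_lifts L g : is_lift pi L -> lifts (L g) g.
Proof. by case=> _ LP Lrho; split. Qed.

End LiftsOfRepresentations.

(** * Existence and number of lifts for the symmetric group *)

Section SymmetricGroupLifts.
Variables (R : realType) (n m : nat) (pi : 'S_n -> 'M[R]_m).
Hypothesis n_ge4 : (4 <= n)%N.
Hypothesis pi_rep : real_rep pi.
Local Notation s := (adj_tr n).
Local Notation chi := (character pi).
Local Notation lifts := (lifts pi).

(** The numbers [a] and [b] are [g_pi] and [h_pi] as natural numbers. Characters are class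
    functions, so the square formulas for [s 1] and [s 1 * s 3] spread to all their conjugates
    listed here. *)
Lemma adj_tr_multiplicities : exists a b : nat,
  [/\ a%:R = (chi 1%g - chi (s 1)) / 2,
      b%:R = (chi 1%g - chi (s 1 * s 3)%g) / 2,
      ~~ odd b,
      forall i, (0 < i < n)%N -> (exists x, lifts x (s i)) /\
        forall x, lifts x (s i) -> x * x = (-1) ^+ 'C(a.+1, 2) &
      forall i j x, (0 < i)%N -> (i.+1 < j < n)%N -> lifts x (s i * s j)%g ->
        x * x = (-1) ^+ 'C(b.+1, 2)].
Proof.
have ss i j : (0 < i)%N -> (i.+1 < j < n)%N -> (s i * s j * (s i * s j) = 1)%g.
  by move=> i0 ij; rewrite {2}adj_tr_far // mulgA -(mulgA (s i)) adj_tr_sqr mulg1 adj_tr_sqr.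
have [a [aE _ _]] := lifts_involution pi_rep (adj_tr_sqr n 1).
have [b [bE _ _]] := lifts_involution pi_rep (@ss 1%N 3%N isT n_ge4).
have aP i : (0 < i < n)%N -> (exists x, lifts x (s i)) /\ forall x, lifts x (s i) ->
    x * x = (-1) ^+ 'C(a.+1, 2) /\ clalpha x = (-1) ^+ a * x.
  move=> iltn; have [d [dE ex dP]] := lifts_involution pi_rep (adj_tr_sqr n i).
  have [|w wE] := @adj_tr_conj n i 1%N iltn; first lia.
  suff <- : d = a by exact: (conj ex dP).
  by apply/eqP; rewrite -(eqr_nat R) dE aE wE characterJ.
have bP i j x : (0 < i)%N -> (i.+1 < j < n)%N -> lifts x (s i * s j)%g ->
    x * x = (-1) ^+ 'C(b.+1, 2) /\ clalpha x = (-1) ^+ b * x.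
  move=> i0 ij; have [d [dE _ dP]] := lifts_involution pi_rep (ss i j i0 ij).
  have [w wE] := @adj_tr_pair_conj n i j 1%N 3%N i0 ij isT n_ge4.
  suff <- : d = b by apply: dP.
  by apply/eqP; rewrite -(eqr_nat R) dE bE wE characterJ.
exists a, b; split => //; last 2 first.
- by move=> i /aP[ex iP]; split => // x /iP[].
- by move=> i j x i0 ij /bP[].
(* Lifts of [s 1] and [s 3] both have parity [a], so their product is fixed by [clalpha], while its
   parity is [b]. *)
have [|[x xs] xa] := aP 1%N; first lia.
have [|[y ys] ya] := aP 3%N; first lia.
have xys := liftsM pi_rep xs ys.
have [_ xyb] := bP 1%N 3%N _ isT n_ge4 xys.
rewrite -(cl_sign_eq1 R m); apply/eqP/(@Pin_regl _ _ (x * y)); first by case: xys.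
rewrite commr_sign -xyb clalphaM (xa _ xs).2 (ya _ ys).2 mulr1.
by rewrite -mulrA [x * (_ * y)]mulrA commr_sign !mulrA -expr2 sqrr_sign mul1r.
Qed.

(** The bound [k] allows the lifts to be chosen one at a time: a new one meets a single braid
    relation, with its predecessor. *)
Lemma lifts_braid_exists k : (k <= n)%N ->
  (forall i, (0 < i < n)%N -> exists x, lifts x (s i)) ->
  exists t : nat -> Cl R m,
    (forall i, (0 < i < k)%N -> lifts (t i) (s i)) /\
    (forall i, (0 < i)%N -> (i.+1 < k)%N -> t i * t i.+1 * t i = t i.+1 * t i * t i.+1).
Proof.
move=> + ex; elim: k => [|k IH] kn; first by exists (fun=> 0); split=> [] [].
have [t [ts tb]] := IH (ltnW kn).
have [k1|k1] := leqP k 0.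
  by exists t; split=> i; lia.
have [x xk] : exists x, lifts x (s k) /\
    ((1 < k)%N -> t k.-1 * x * t k.-1 = x * t k.-1 * x).
  have [|x xk] := ex k; first lia.
  have [k1'|k1'] := leqP k 1; first by exists x; split => //; lia.
  have tk : lifts (t k.-1) (s k.-1) by apply: ts; lia.
  have b1 := liftsM pi_rep (liftsM pi_rep tk xk) tk.
  have b2 := liftsM pi_rep (liftsM pi_rep xk tk) xk.
  rewrite -[in X in lifts _ (_ * s X * _)%g](ltn_predK k1) in b1.
  rewrite adj_tr_braid ?(ltn_predK k1) in b1; [|lia..].
  (* The two sides lie over the same permutation. One is odd in [x] and the other even, so if they
     differ by a sign, [- x] repairs it. *)
  have [E|E] := lifts_fiber b1 b2; first by exists x; split.
  exists (- x); split; first exact: liftsN.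
  by rewrite !(mulrN, mulNr) opprK E.
exists (fun i => if i == k then x else t i); split=> i.
  by have [-> _|ik] := eqVneq i k; [case: xk | move=> ?; apply: ts; lia].
move=> i0 ik; have [E|E] := eqVneq i.+1 k.
  rewrite ifN; last lia.
  by have [_] := xk; rewrite -E => ->.
by rewrite ifN ?tb //; lia.
Qed.

Lemma spinorial_of_squares :
  (forall i, (0 < i < n)%N -> (exists x, lifts x (s i)) /\
     forall x, lifts x (s i) -> x * x = 1) ->
  (forall i j x, (0 < i)%N -> (i.+1 < j < n)%N -> lifts x (s i * s j)%g -> x * x = 1) ->
  spinorial pi.
Proof.
move=> sP ssP.
have [i /sP[]//|t [tl tb]] := @lifts_braid_exists n (leqnn n).
have t2 i : (0 < i < n)%N -> t i * t i = 1 by move=> iltn; apply: (sP i iltn).2; exact: tl.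
have tf i j : (0 < i)%N -> (i.+1 < j < n)%N -> t i * t j = t j * t i.
  move=> i0 ij; have ti : lifts (t i) (s i) by apply: tl; lia.
  have tj : lifts (t j) (s j) by apply: tl; lia.
  have := ssP i j _ i0 ij (liftsM pi_rep ti tj).
  (* Multiplying [(t i * t j)^2 = 1] by [t i] on the left and [t j] on the right turns it into
     commutation. *)
  move=> /(congr1 (fun z => t i * z * t j)); rewrite mulr1 => <-.
  by rewrite !mulrA t2 ?mul1r -?mulrA ?t2 ?mulr1 //; lia.
have [L [LM LP]] := coxeter_extension t2 tf tb.
have Ll g : lifts (L g) g.
  have [w [lw -> ->]] := LP g; elim: w lw => [|i w IH] /=.
    by rewrite /word_ring /word_perm !big_nil => _; apply: lifts1.
  case/andP=> iltn /IH; rewrite /word_ring /word_perm !big_cons.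
  by apply: liftsM => //; apply: tl.
by exists L; split=> // g; case: (Ll g).
Qed.

Definition sign_twist (L : 'S_n -> Cl R m) (g : 'S_n) : Cl R m := (-1) ^+ odd_perm g * L g.

Lemma is_lift_sign_twist L : is_lift pi L -> is_lift pi (sign_twist L).
Proof.
move=> [LM LP Lrho]; split=> [g h|g|g]; rewrite /sign_twist.
- rewrite odd_permM signr_addb LM -![clmul _ _]/(_ * _ : Cl R m) -!mulrA.
  by congr (_ * _); rewrite !mulrA commr_sign.
- by case: (odd_perm g); rewrite ?mulN1r ?mul1r //; apply: in_PinN.
- by case: (odd_perm g); rewrite ?mulN1r ?mul1r //; apply: rho_isN.
Qed.

(* The ratio of two lifts is a homomorphism to [{1, -1}], hence constant on
   transpositions since these are conjugate. *)
Lemma lift_eq_or_twist L L' : is_lift pi L -> is_lift pi L' ->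
  L' =1 L \/ L' =1 sign_twist L.
Proof.
move=> Ll Ll'; pose c g := L' g != L g.
have cP g : L' g = (-1) ^+ c g * L g.
  rewrite /c; case: eqP => [->|ne]; first by rewrite mul1r.
  have [//|->] := lifts_fiber (is_lift_lifts g Ll) (is_lift_lifts g Ll').
  by rewrite mulN1r.
have LN g : L g != - L g by apply: Pin_neqN; case: Ll.
have cM g h : c (g * h)%g = c g (+) c h.
  have E : (-1) ^+ c (g * h)%g * L (g * h)%g = (-1) ^+ (c g (+) c h) * L (g * h)%g.
    rewrite -cP; case: Ll Ll' => LM _ _ [LM' _ _].
    rewrite LM LM' -![clmul _ _]/(_ * _ : Cl R m) !cP signr_addb -!mulrA.
    by congr (_ * _); rewrite !mulrA commr_sign.
  move: E (LN (g * h)%g); case: (c _); case: (_ (+) _) => //=;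
    rewrite ?expr0 ?expr1 ?mul1r ?mulN1r => /eqP E /negP[] //; by rewrite eq_sym.
have c1 : c 1%g = false by rewrite /c !(is_lift1 Ll, is_lift1 Ll') eqxx.
have cJ g h : c (g ^ h)%g = c g.
  have := cM h^-1%g h; rewrite mulVg c1 conjgE !cM.
  by case: (c _); case: (c _); case: (c _).
have ct (a b : 'I_n) : a != b -> c (tperm a b) = c (s 1).
  move=> ab; have [|w ->] := @tperm_conj_adj_tr n a b 1%N ab; first lia.
  by rewrite cJ.
have cE g : c g = c (s 1) && odd_perm g.
  have [ts -> ] := prod_tpermP g; elim: ts => [|[a b] ts IH] /=.
    by rewrite big_nil c1 odd_perm1 andbF.
  case/andP=> ab /IH {}IH; rewrite big_cons cM odd_permM IH ct // odd_tperm ab.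
  by case: (c _); case: (odd_perm _).
have [cs|cs] := boolP (c (s 1)); [right|left] => g; rewrite cP cE.
  by rewrite cs.
by rewrite (negPf cs) mul1r.
Qed.

End SymmetricGroupLifts.

(** * Congruence conditions and the equivalence *)

Lemma nat_mod4_03 (R : numDomainType) (a : nat) :
  (exists k : int, a%:R = (4 * k)%:~R :> R \/ a%:R = (4 * k + 3)%:~R :> R) <->
  (a %% 4)%N = 0%N \/ (a %% 4)%N = 3%N.
Proof.
split.
  by case=> k [] /eqP; rewrite -[a%:R]/(a%:Z%:~R) eqr_int => /eqP; lia.
by case=> E; exists (a %/ 4)%N; [left | right];
  rewrite -[a%:R]/(a%:Z%:~R); congr (_%:~R); lia.
Qed.

Lemma nat_mod4_0 (R : numDomainType) (a : nat) :
  (exists k : int, a%:R = (4 * k)%:~R :> R) <-> (a %% 4)%N = 0%N.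
Proof.
split.
  by case=> k /eqP; rewrite -[a%:R]/(a%:Z%:~R) eqr_int => /eqP; lia.
by move=> E; exists (a %/ 4)%N; rewrite -[a%:R]/(a%:Z%:~R); congr (_%:~R); lia.
Qed.

Theorem theorem3p4 (R : realType) (n m : nat) (pi : 'S_n -> 'M[R]_m) :
  (4 <= n)%N -> real_rep pi ->
  let chi := character pi in
  let s1 := adj_tr n 1 in
  let s3 := adj_tr n 3 in
  let g_pi := (chi 1%g - chi s1) / 2 in
  let h_pi := (chi 1%g - chi (s1 * s3)%g) / 2 in
  let cond2 := (exists k : int, g_pi = (4 * k)%:~R \/ g_pi = (4 * k + 3)%:~R)
               /\ (exists k : int, h_pi = (4 * k)%:~R) in
  let cond3 := (exists k : int, chi 1%g - chi s1 = (8 * k)%:~R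
                                 \/ chi 1%g - chi s1 = (8 * k + 6)%:~R)
               /\ (exists k : int, chi 1%g - chi (s1 * s3)%g = (8 * k)%:~R) in
  [/\ spinorial pi <-> cond2,
      cond2 <-> cond3
    & spinorial pi ->
      exists L1 L2 : 'S_n -> Cl R m,
        [/\ L1 <> L2, is_lift pi L1, is_lift pi L2
          & forall L, is_lift pi L -> L = L1 \/ L = L2]].
Proof.
move=> n4 pi_rep chi s1 s3 g_pi h_pi cond2 cond3.
(* Passes between moduli 4 and 8: [8 k] and [8 k + 6] are the doubles of [4 k] and [4 k + 3]. *)
have half (z : R) (k l : int) : l = 2 * k -> (z / 2 = k%:~R) <-> (z = l%:~R).
  by move=> ->; rewrite intrM; split=> [<-|->]; field.
split.
- have [a [b [aE bE b2 sP ssP]]] := adj_tr_multiplicities n4 pi_rep.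
  rewrite /cond2 /g_pi /h_pi -aE -bE nat_mod4_03 nat_mod4_0.
  split=> [[L Ll]|[amod bmod]].
    (* A homomorphic lift sends involutions to elements of square 1, so the sign exponents computed
       for arbitrary lifts must be even. *)
    have L2 g : (g * g = 1)%g -> L g * L g = 1.
      move=> gg; rewrite -(is_lift1 Ll) -gg; case: Ll => LM _ _.
      by rewrite [in RHS]LM.
    have odd2 : ~~ odd 'C(a.+1, 2).
      rewrite -(cl_sign_eq1 R m) -((sP 1%N _).2 _ (is_lift_lifts _ Ll)); last lia.
      by rewrite L2 // adj_tr_sqr.
    have odd3 : ~~ odd 'C(b.+1, 2).
      rewrite -(cl_sign_eq1 R m) -(ssP 1%N 3%N _ _ n4 (is_lift_lifts _ Ll)) //.
      rewrite L2 // {2}adj_tr_far // mulgA -(mulgA (adj_tr n 1)).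
      by rewrite adj_tr_sqr mulg1 adj_tr_sqr.
    (* The square condition alone leaves [b] congruent to 0 or 3 modulo 4; evenness of [b] excludes
       3. *)
    by move: odd2 odd3 b2; rewrite !odd_bin2S !inE; lia.
  have odd2 : ~~ odd 'C(a.+1, 2) by rewrite odd_bin2S !inE; lia.
  have odd3 : ~~ odd 'C(b.+1, 2) by rewrite odd_bin2S !inE; lia.
  apply: spinorial_of_squares => // [i /sP[ex iP]|i j x i0 ij xl].
    by split=> // x /iP ->; apply/eqP; rewrite cl_sign_eq1.
  by rewrite (ssP i j x i0 ij xl); apply/eqP; rewrite cl_sign_eq1.
- rewrite /cond2 /cond3 /g_pi /h_pi; split=> -[[k kE] [l lE]]; split.
  + exists k; case: kE => kE; [left | right]; move: kE; apply: (half _ _ _ _).1; lia.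
  + exists l; move: lE; apply: (half _ _ _ _).1; lia.
  + exists k; case: kE => kE; [left | right]; move: kE; apply: (half _ _ _ _).2; lia.
  + exists l; move: lE; apply: (half _ _ _ _).2; lia.
case=> L Ll; exists L, (sign_twist L); split => //.
(* The two lifts already differ at the odd permutation [s_1], where they are opposite elements of
   Pin. *)
- move=> /(congr1 (fun F => F (adj_tr n 1))) /eqP; apply/negP.
  have [|a [b [ai bi sE]]] := @adj_tr_exists n 1; first lia.
  rewrite /sign_twist sE odd_tperm -val_eqE /= ai bi mulN1r.
  by apply: Pin_neqN; case: Ll.
- exact: is_lift_sign_twist.
by move=> L' Ll'; have [|] := lift_eq_or_twist n4 Ll Ll' => E; [left | right]; apply: funext.
Qed.
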